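(* Let $b>0$. A kernel $k\in L^1(0,b)$ satisfies the Sonine condition (SC) if and only if it satisfies the generalized Sonine condition (gSC).
   Context: All functions are real-valued. Let $b>0$ and $k\in L^1(0,b)$. Sonine condition (SC): there exists $K\in L^1(0,b)$ such that $$\int_0^t K(t-s)k(s)\,ds=1\quad\text{for almost all } t\in(0,b).$$ Generalized Sonine condition (gSC): there exist $K\in L^1(0,b)$ and a function $g:[0,b]\to\mathbb{R}$, continuous on $[0,b]$ and differentiable on $(0,b)$, with $g'\in L^1(0,b)$ and $g(0)=1$, such that $$\int_0^t K(t-s)k(s)\,ds=g(t)\quad\text{for almost all } t\in(0,b).$$ The kernel $K$ in the two conditions need not be the same. *)

(* Defs.v *)
From HB Require Import structures.
From mathcomp Require Import all_boot all_order all_algebra.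
From mathcomp Require Import all_classical all_reals all_analysis.
Import Order.TTheory GRing.Theory Num.Theory.
Import numFieldNormedType.Exports.

Set Implicit Arguments.
Unset Strict Implicit.
Unset Printing Implicit Defensive.

Local Open Scope classical_set_scope.
Local Open Scope ring_scope.

(* A function on (0, b) is given by a total function R -> R whose values
   outside ]0, b[ are irrelevant, and an element of L^1(0, b) by a Borel
   measurable representative. *)
Definition L1 (R : realType) (b : R) (f : R -> R) : Prop :=
  (@lebesgue_measure R).-integrable `]0, b[ (EFin \o f).

(* The integral is kept in \bar R, where +oo - +oo = -oo: for measurable K and
   k, an equation [sonine_conv K k t = c%:E] then forces the integrand to be
   integrable, whereas the real-valued [Rintegral] returns 0 at a t where the
   integral is infinite. *)
Definition sonine_conv (R : realType) (K k : R -> R) (t : R) : \bar R :=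
  (\int[@lebesgue_measure R]_(s in `]0%R, t[) (K (t - s)%R * k s)%:E)%E.

Definition SC (R : realType) (b : R) (k : R -> R) : Prop :=
  exists2 K : R -> R, L1 b K &
    {ae (@lebesgue_measure R), forall t, `]0, b[%classic t ->
      sonine_conv K k t = 1%:E}.

Definition gSC (R : realType) (b : R) (k : R -> R) : Prop :=
  exists K g : R -> R,
    [/\ L1 b K,
        {within `[0, b], continuous g} /\
        (forall t, t \in `]0, b[ -> derivable g t 1),
        L1 b (derive1 g),
        g 0 = 1 &
        {ae (@lebesgue_measure R), forall t, `]0, b[%classic t ->
          sonine_conv K k t = (g t)%:E}].

(* Main.v *)
Require Import Defs.
From HB Require Import structures.
From mathcomp Require Import all_boot all_order all_algebra.
From mathcomp Require Import all_classical all_reals all_analysis.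
From mathcomp Require Import measurable_realfun ring lra.
Import Order.TTheory GRing.Theory Num.Theory.
Import numFieldNormedType.Exports.

(** The Sonine condition is the generalized one with [g = 1].  Conversely,
    suppose [K * k = g] almost everywhere on (0, b), where [*] is the convolution
    on the half-line.  As [g] is the integral of its derivative and [g 0 = 1],
    this reads [K * k = 1 + g' * 1], that is, [(delta + g') * 1] with [delta] the
    unit of convolution.  The idea is to divide by [delta + g']: a Volterra
    equation of the second kind can always be solved in L^1, so there is [K'] with
    [K' + g' * K' = K].  Then [K' * k] and [1] have the same image under
    convolution with [delta + g'], and that operator is injective, so
    [K' * k = 1].

    Both the solvability and the injectivity come from a contraction.  All
    functions are multiplied by [exp (- l x)] and extended by zero outside
    (0, b).  This weighting is multiplicative for convolution, and by dominated
    convergence the weighted [g'] has L^1 norm at most 1/2 once [l] is large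
    ([small_weight]).  Convolution on the whole line with
    [p = - exp (- l x) g'] then halves the L^1 norm, and the Neumann series of
    [p] converges ([neumann_series]).  Extension by zero spoils the equations to
    the right of [b]; this does no harm because [p] vanishes on the negative
    half-line, so that an equation on (-oo, c) only involves values there
    ([convolve_fixpoint_ae0]).  With associativity of convolution, which is
    Fubini's theorem ([ae_convolveA]), this gives [volterra_sonine].

    The remaining point is that [g] is the integral of [g'] when [g'] exists
    everywhere and is merely integrable ([FTC2_derivable_oo]).  Let
    [F] be the primitive of [min g' n].  At a Lebesgue point of [min g' n] the
    function [g - F] has derivative [g' - min g' n >= 0].  At the other points,
    which form a null set, [F] still grows with slope at most [n] and [g'] is
    finite, so that adding the primitive of an integrable function with small
    integral and infinite density at those points ([null_set_weight]) makes the
    sum increase to the right there as well.  A continuous function that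
    increases to the right of each point is monotone, hence the integral of
    [min g' n] is at most the increment of [g]; let [n] tend to infinity, then
    apply the inequality to [- g]. *)

Set Implicit Arguments.
Unset Strict Implicit.
Unset Printing Implicit Defensive.

Local Open Scope classical_set_scope.
Local Open Scope ring_scope.

(** * Reflections and translations of the Lebesgue integral *)

Lemma measurable_reflect (R : realType) (c : R) :
  measurable_fun setT ((fun s => c - s) : measurableTypeR R -> measurableTypeR R).
Proof. exact: measurable_funB. Qed.

Lemma lebesgue_measure_reflect (R : realType) (c : R) (A : set R) :
  measurable A ->
  pushforward (@lebesgue_measure R) ((fun s => c - s) : _ -> measurableTypeR R) A =
      lebesgue_measure A.
Proof.
move=> mA; apply/esym/lebesgue_measure_unique => //=; first exact: measurable_reflect.
move=> mB  _ [[a b]] _ <-.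
rewrite /pushforward.
rewrite (_ : _ @^-1` _ = `[c - b, c - a[%classic).
  rewrite !lebesgue_measure_itv/= !lte_fin ltrD2l ltrN2.
  by case: ifPn => // _; rewrite -!EFinB; congr EFin; lra.
apply/seteqP; split => x /=; rewrite !in_itv /= => /andP[h1 h2]; apply/andP; split; lra.
Qed.

Lemma integral_reflect (R : realType) (c : R) (f : R -> \bar R) :
  measurable_fun setT f ->
  (\int[@lebesgue_measure R]_s f (c - s)%R = \int[@lebesgue_measure R]_s f s)%E.
Proof.
have ge0 (h : R -> \bar R) : measurable_fun setT h -> (forall x, 0 <= h x)%E ->
    (\int[@lebesgue_measure R]_s h (c - s)%R = \int[@lebesgue_measure R]_s h s)%E.
  move=> mh h0.
  have := @ge0_integral_pushforward _ _ _ _ _ _ (measurable_reflect c)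
      (@lebesgue_measure R) setT h.
  rewrite preimage_setT /= => <- //.
  by apply: eq_measure_integral => [|? A mA _];
      [exact: measurable_reflect|exact: lebesgue_measure_reflect].
move=> mf; rewrite integralE [RHS]integralE; congr (_ - _)%E.
  under eq_integral do rewrite (funepos_comp f (fun s => c - s)) /=.
  exact: (ge0 _ (measurable_funepos mf) (fun x => funepos_ge0 f x)).
under eq_integral do rewrite (funeneg_comp f (fun s => c - s)) /=.
exact: (ge0 _ (measurable_funeneg mf) (fun x => funeneg_ge0 f x)).
Qed.

Lemma integral_shift (R : realType) (c : R) (f : R -> \bar R) :
  measurable_fun setT f ->
  (\int[@lebesgue_measure R]_s f (s - c)%R = \int[@lebesgue_measure R]_s f s)%E.
Proof.
move=> mf; rewrite -(@integral_reflect _ 0 f) // -(@integral_reflect _ c (fun s =>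
    f (0 - s)%R)).
  by apply: eq_integral => s _; congr f; lra.
exact: (measurableT_comp mf (measurable_reflect 0)).
Qed.

Lemma intR_measurable (R : realType) (f : R -> R) :
  (@lebesgue_measure R).-integrable setT (EFin \o f) -> measurable_fun setT f.
Proof. by move=> /measurable_int/measurable_EFinP. Qed.

#[local] Instance lebesgue_ae_filter (R : realType) :
  Filter (almost_everywhere (@lebesgue_measure R)) :=
  ae_filter_ringOfSetsType _.

(** * The fundamental theorem of calculus for a derivative that exists everywhere *)

Section derivative_integral.
Context {R : realType}.
Implicit Types (f phi w : R -> R) (a b c x y z h e : R).
Local Notation mu := (@lebesgue_measure R).
Local Notation intR f := (mu.-integrable setT (EFin \o f)).

(** A maximum over [a, b] can only be attained at [b], since a larger value
    is found to the right of any other point. *)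
Lemma le_of_right_increase f a b : a <= b -> {within `[a, b], continuous f} ->
  (forall x, a <= x < b -> exists2 y, x <= y <= b & f x < f y) -> f a <= f b.
Proof.
move=> ab cf inc.
have [c cab cmax] := EVT_max ab cf.
have [<-|cb] := eqVneq c b.
  by apply: cmax; rewrite in_itv /= lexx.
move: cab; rewrite in_itv /= => /andP[ac cb'].
have [|y /andP[cy yb]] := inc c; first by rewrite ac lt_neqAle cb.
by rewrite ltNge cmax // in_itv /= yb (le_trans ac).
Qed.

Lemma near_right_increment f z c : derivable f z 1 -> c < derive1 f z ->
  \forall h \near 0^'+, c * h < f (h + z) - f z.
Proof.
move=> df; rewrite derive1E => cf.
have cvf : h^-1 *: (f (h *: 1 + z) - f z) @[h --> 0^'] --> 'D_1 f z by exact: df.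
have /cvgr_gt/(_ c cf) near_c := cvg_dnbhs_at_right cvf.
near=> h.
have h0 : 0 < h by near: h; exact: nbhs_right_gt.
have : c < h^-1 *: (f (h *: 1 + z) - f z) by near: h.
by rewrite -[h *: 1]/(h * 1) mulr1 -[_ *: _]/(_ * _) ltr_pdivlMl // mulrC.
Unshelve. all: by end_near. Qed.

Lemma Rintegral_itvcc_split phi x y z : intR phi -> x <= y -> y <= z ->
  \int[mu]_(t in `[x, z]) phi t - \int[mu]_(t in `[x, y]) phi t =
  \int[mu]_(t in `[y, z]) phi t.
Proof.
move=> intphi xy yz; rewrite Rintegral_itvB ?bnd_simp //.
  by rewrite Rintegral_itv_obnd_cbnd //; exact: integrableS intphi.
exact: integrableS intphi.
Qed.

(** The weight is the sum of the indicators of open neighborhoods [V k] of the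
    null set, with measures summing up to at most [e].  A point of the null set
    is interior to the intersection of the first [m] of them, where the sum is at
    least [m]; since [m] is arbitrary, the primitive of the weight has infinite
    derivative at that point. *)
Lemma null_set_weight (N : set R) e : measurable N -> mu N = 0%E -> 0 < e ->
  exists w, [/\ forall x, 0 <= w x, intR w, \int[mu]_x w x <= e &
    forall z, N z -> forall m : nat, \forall h \near 0^'+,
      m%:R * h <= \int[mu]_(t in `[z, h + z]) w t].
Proof.
move=> mN N0 e0.
have ek k : 0 < e / (2 ^ (k + 0.+1))%:R by rewrite divr_gt0 // ltr0n expn_gt0.
have Nfin : (mu N < +oo)%E by rewrite N0.
have cho k : exists U : set R, [/\ open U, N `<=` U & (mu U <= (e / (2 ^ (k +
    0.+1))%:R)%:E)%E].
  have [U [oU NU Ue]] := lebesgue_regularity_outer mN Nfin (ek k).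
  exists U; split => //.
  have mU : measurable U := open_measurable oU.
  rewrite -(setDUK NU) measureU //; last by rewrite setDIK.
    rewrite [X in (X + _ <= _)%E](_ : _ = 0%E); last exact: N0.
    by rewrite add0e ltW.
  exact: measurableD.
have [V VP] := choice cho.
pose s x : \bar R := (\sum_(k <oo) (\1_(V k) x)%:E)%E.
have mO k : measurable (V k) by have [/open_measurable] := VP k.
have mi k : measurable_fun setT (fun x => (\1_(V k) x : R)%:E).
  by apply/measurable_EFinP; exact: measurable_indic.
have s0 x : (0 <= s x)%E by apply: nneseries_ge0 => k _ _; rewrite lee_fin.
have ms : measurable_fun setT s.
  by apply: (@ge0_emeasurable_sum _ _ _ _ (fun k x => (\1_(V k) x)%:E) xpredT).
have ints_le : (\int[mu]_x s x <= e%:E)%E.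
  rewrite integral_nneseries //.
  apply: (@le_trans _ _ (\sum_(k <oo) (e / (2 ^ (k + 0.+1))%:R)%:E)%E).
    apply: lee_nneseries => [k _ _|k _]; first exact: integral_ge0.
    have iV : (\int[mu]_x (\1_(V k) x)%:E = mu (V k))%E.
      by rewrite integral_indic ?setIT //; exact: mO.
    by rewrite [leLHS]iV; have [] := VP k.
  have := @cvg_geometric_eseries_half _ e 0; rewrite expr0 divr1 => /cvg_lim.
  by rewrite /eseries /= => ->.
have ints : mu.-integrable setT s.
  apply/integrableP; split => //; under eq_integral do rewrite gee0_abs //.
  by rewrite (le_lt_trans ints_le) // ltry.
(* The sum may be infinite on a null set, where [fine] returns 0. *)
pose w := fine \o s.
have mw : measurable_fun setT w by exact: (measurableT_comp (@fine_measurable _ setT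
    measurableT) ms).
have w0 x : 0 <= w x by rewrite fine_ge0.
have sw : ae_eq mu setT s (EFin \o w).
  by apply: filterS (integrable_ae measurableT ints) => x /[apply] sx;
      rewrite /= /w /= fineK.
have intwE (A : set R) : measurable A -> (\int[mu]_(x in A) (w x)%:E =
    \int[mu]_(x in A) s x)%E.
  move=> mA; apply: ge0_ae_eq_integral => //.
  - by apply/measurable_EFinP; exact: measurable_funTS.
  - exact: measurable_funTS.
  - by move=> x _; rewrite lee_fin.
  - by apply: ae_eq_sym; exact: ae_eq_subset sw.
have intw : intR w.
  apply/integrableP; split; first exact/measurable_EFinP.
  under eq_integral do rewrite /= ger0_norm //.
  by rewrite intwE // (le_lt_trans ints_le) // ltry.
exists w; split => //.
  rewrite -lee_fin /Rintegral fineK; last exact: integrable_fin_num.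
  by rewrite intwE.
move=> z Nz m.
have nearO : \forall h \near 0^'+, forall k, (k < m)%N -> `[z - h, z + h] `<=` V k.
  elim: m => [|m IH]; first exact: nearW.
  have [oO NO _] := VP m.
  apply: filterS2 IH (open_itvcc_subset oO (NO _ Nz)) => h h1 h2 k.
  by rewrite ltnS leq_eqVlt => /predU1P[->//|]; exact: h1.
near=> h.
have h0 : 0 < h by near: h; exact: nbhs_right_gt.
have hO : forall k, (k < m)%N -> `[z - h, z + h] `<=` V k by near: h.
have sm t : t \in `[z, h + z]%R -> (m%:R%:E <= s t)%E.
  rewrite in_itv /= => /andP[zt th].
  apply: (@le_trans _ _ (\sum_(0 <= k < m) (\1_(V k) t)%:E)%E); last first.
    by apply: nneseries_lim_ge => k _ _; rewrite lee_fin.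
  rewrite sumEFin lee_fin.
  rewrite (eq_big_nat _ _ (F2 := fun=> 1)) ?big_const_nat; last first.
    move=> k /= km; rewrite indicE mem_set //; apply: (hO k km) => /=.
    by rewrite in_itv /=; apply/andP; split; lra.
  by rewrite iter_addr addr0 subn0.
have -> : m%:R * h = \int[mu]_(t in `[z, h + z]) m%:R.
  rewrite Rintegral_cst //= lebesgue_measure_itv /= lte_fin ltrDr h0.
  by rewrite -EFinB /= addrK.
rewrite /Rintegral fine_le //.
- rewrite integral_cst //= lebesgue_measure_itv /=; case: ifP => // _; rewrite mule0;
    exact: fin_num0.
- apply: integrable_fin_num => //; exact: integrableS intw.
rewrite intwE //; apply: ge0_le_integral => //.
exact: measurable_funTS.
Unshelve. all: by end_near. Qed.

Lemma integrable_minr f (A : set R) (n : nat) : measurable A ->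
  mu.-integrable A (EFin \o f) ->
  mu.-integrable A (EFin \o (fun z => Num.min (f z) n%:R)).
Proof.
move=> mA intf; have /measurable_int/measurable_EFinP mf := intf.
apply: (le_integrable _ _ _ intf) => //.
  by apply/measurable_EFinP; apply: measurable_minr => //; exact: measurable_cst.
move=> z _ /=; rewrite lee_fin.
have [//|nf] := leP (f z) n%:R.
by rewrite ger0_norm // (le_trans (ltW nf)) // ler_norm.
Qed.

(** The arithmetic of the right increment of [f - F + W + e x] at a
    Lebesgue point of the truncated derivative, where [s = e h]. *)
Let increment_gt0_lebesgue (a a' b b' I s : R) :
  - s < a - b - (a' - b') -> 0 <= I -> 0 < a - a' - (b - b') + I + s.
Proof. lra. Qed.

(** The same increment at a point that is not a Lebesgue point: [d] is the
    derivative of [f] and [m] a lower bound on the slope of [W], large enough to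
    beat the upper bound [n] on the slope of [F]. *)
Let increment_gt0_null (n m d h e df dF I : R) : n + 1 - d <= m -> 0 < h -> 0 < e ->
  m * h <= I -> (d - 1) * h < df -> dF <= n * h -> 0 < df - dF + I + e * h.
Proof. nra. Qed.

Let telescope_le (fx fy Fx Fy W e l : R) : W <= e ->
  fx - Fx + 0 + e * 0 <= fy - Fy + W + e * l -> Fy - Fx <= fy - fx + (e + e * l).
Proof. lra. Qed.

(** Truncating the derivative from above keeps the slopes of its primitive
    [F] bounded above, even at the points where [F] is not differentiable; this is
    the direction that matters for [f - F] to increase. *)
Lemma Rintegral_minr_derive1_le f x y (n : nat) : x < y ->
  (forall z, x <= z <= y -> derivable f z 1) ->
  mu.-integrable `[x, y] (EFin \o derive1 f) ->
  \int[mu]_(z in `[x, y]) Num.min (derive1 f z) n%:R <= f y - f x.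
Proof.
move=> xy df intdf.
pose phi := (fun z => Num.min (derive1 f z) n%:R) \_ `[x, y].
have phiE z : x <= z <= y -> phi z = Num.min (derive1 f z) n%:R.
  by move=> zxy; rewrite /phi patchE mem_set //= in_itv.
have phin z : phi z <= n%:R.
  by rewrite /phi patchE; case: ifP => _ //; rewrite ge_min lexx orbT.
have intphi : intR phi.
  rewrite -restrict_EFin; apply/integrable_restrict => //=; rewrite setTI.
  exact: integrable_minr.
have -> : \int[mu]_(z in `[x, y]) Num.min (derive1 f z) n%:R =
    \int[mu]_(z in `[x, y]) phi z.
  apply: eq_Rintegral => z; rewrite inE /= in_itv /= => zxy.
  by rewrite phiE.
(* Starting at [x - 1] makes [x] an interior point; [phi] is 0 before [x]. *)
pose F z := \int[mu]_(t in `[x - 1, z]) phi t.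
have x1x : x - 1 <= x by rewrite lerBlDr lerDl.
rewrite -(Rintegral_itvcc_split intphi x1x (ltW xy)) -/(F y) -/(F x).
have locphi : locally_integrable setT phi.
  by apply: open_integrable_locally => //; exact: openT.
have [N [mN N0 HN]] := lebesgue_differentiation locphi.
have dF z : x <= z -> ~ N z -> derivable F z 1 /\ derive1 F z = phi z.
  move=> xz Nz.
  apply: (@FTC1_lebesgue_pt _ phi (BLeft (x - 1)) z (z + 1)).
  - by rewrite ltrDl.
  - exact: integrableS intphi.
  - by rewrite /= lte_fin ltrBlDr ltr_pwDr.
  by apply: contrapT => nz; apply: Nz; exact: HN.
apply/ler_addgt0Pr => e0 e0_gt0.
pose e := e0 / (1 + (y - x)).
have yx0 : 0 < y - x by rewrite subr_gt0.
have e_gt0 : 0 < e by rewrite divr_gt0 // addr_gt0.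
have [w [w0 intw we wN]] := null_set_weight mN N0 e_gt0.
pose W z := \int[mu]_(t in `[x, z]) w t.
(* The last term makes the increase strict. *)
pose G z := f z - F z + W z + e * (z - x).
have Wy : W y <= e.
  apply: le_trans we; rewrite /W /Rintegral fine_le //.
  - by apply: integrable_fin_num => //; exact: integrableS intw.
  - exact: integrable_fin_num.
  apply: ge0_subset_integral => //; last by move=> ? _; rewrite lee_fin.
  by apply/measurable_EFinP; exact: intR_measurable.
have W_inc z h : x <= z -> 0 <= h -> W (h + z) - W z = \int[mu]_(t in `[z, h + z]) w t.
  by move=> xz h0; apply: Rintegral_itvcc_split => //; rewrite lerDr.
have F_inc z h : x <= z -> 0 <= h -> F (h + z) - F z <= n%:R * h.
  move=> xz h0; rewrite /F Rintegral_itvcc_split ?(le_trans x1x) //;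
      last by rewrite lerDr.
  apply: (@le_trans _ _ (\int[mu]_(t in `[z, h + z]) n%:R)).
    apply: le_Rintegral => //; first exact: integrableS intphi.
    apply/integrableP; split; first exact/measurable_EFinP/measurable_cst.
    rewrite integral_cst //= lebesgue_measure_itv /=; case: ifP => _;
        rewrite ?mule0 ?ltry // -EFinM ltry.
  rewrite Rintegral_cst //= lebesgue_measure_itv /= lte_fin ltrDr.
  by case: ltP => h0'; [rewrite -EFinB /= addrK|rewrite mulr0 mulr_ge0].
have Gxy : G x <= G y.
  apply: le_of_right_increase; first exact: ltW.
    have cf : {within `[x, y], continuous f}.
      by apply: derivable_within_continuous => z; rewrite in_itv; exact: df.
    have cF : {within `[x, y], continuous F}.
      apply: (@continuous_subspaceW _ _ _ `[x - 1, y]).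
        by move=> z /=; rewrite !in_itv /= => /andP[xz ->]; rewrite (le_trans x1x).
      by apply: parameterized_integral_continuous; [rewrite (le_trans x1x) //
          ltW|exact: integrableS intphi].
    have cW : {within `[x, y], continuous W}.
      by apply: parameterized_integral_continuous; [exact: ltW|exact: integrableS intw].
    have cl : {within `[x, y], continuous (fun z => e * (z - x))}.
      apply: continuous_subspaceT => z; apply: cvgM; first exact: cvg_cst.
      by apply: cvgB => //; exact: cvg_cst.
    move=> z; apply: cvgD; last exact: cl.
    by apply: cvgD; [apply: cvgB; [exact: cf|exact: cF]|exact: cW].
  move=> z /andP[xz zy].
  suff : \forall h \near 0^'+, G z < G (h + z).
    have zy0 : 0 < y - z by rewrite subr_gt0.
    move=> Ginc.
    have [h [[h1 h2] h3]] :=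
        filter_ex (filterI (filterI Ginc (nbhs_right_gt 0)) (nbhs_right_le zy0)).
    by exists (h + z) => //; rewrite lerDr (ltW h2) -lerBrDr.
  have dfz : derivable f z 1 by apply: df; rewrite xz ltW.
  have GE h : G (h + z) - G z = (f (h + z) - f z) - (F (h + z) - F z) + (W (h +
      z) - W z) + e * h.
    by rewrite /G; ring.
  have [Nz|Nz] := pselect (N z); last first.
    have [dFz dFzE] := dF z xz Nz.
    have dfF : derivable (f - F) z 1 by exact: derivableB.
    have dfFE : - e < derive1 (f - F) z.
      rewrite derive1E deriveB // -!derive1E dFzE phiE ?xz ?ltW //
          (@lt_le_trans _ _ 0) ?oppr_lt0 //.
      by rewrite subr_ge0 ge_min lexx.
    have inc := near_right_increment dfF dfFE.
    apply: filterS2 inc (nbhs_right_gt 0) => h i1 h0.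
    rewrite -subr_gt0 GE (W_inc _ _ xz (ltW h0)).
    have i0 : 0 <= \int[mu]_(t in `[z, h + z]) w t by apply: Rintegral_ge0.
    by apply: increment_gt0_lebesgue i0; rewrite -mulNr.
  (* [f] has slope above [derive1 f z - 1] near [z] and [F] slope at most [n],
     so [W] has to make up for [n + 1 - derive1 f z]. *)
  pose m := Num.bound `|n%:R + 1 - derive1 f z|.
  have mE : n%:R + 1 - derive1 f z <= m%:R by apply: (le_trans (ler_norm _));
      apply/ltW/archi_boundP.
  have inc : \forall h \near 0^'+, (derive1 f z - 1) * h < f (h + z) - f z.
    by apply: near_right_increment => //; rewrite ltrBlDr ltrDl.
  have wz := wN z Nz m.
  apply: filterS3 wz inc (nbhs_right_gt 0) => h i1 i2 h0.
  rewrite -subr_gt0 GE (W_inc _ _ xz (ltW h0)).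
  have i3 := F_inc z h xz (ltW h0).
  exact: increment_gt0_null mE h0 e_gt0 i1 i2 i3.
have Wx : W x = 0 by rewrite /W set_itv1 Rintegral_set1.
have eE : e0 = e + e * (y - x) by rewrite /e; field; rewrite gt_eqF // addr_gt0.
by rewrite eE; apply: (telescope_le Wy); move: Gxy; rewrite /G Wx subrr.
Qed.

Lemma Rintegral_derive1_le f x y : x < y ->
  (forall z, x <= z <= y -> derivable f z 1) ->
  mu.-integrable `[x, y] (EFin \o derive1 f) ->
  \int[mu]_(z in `[x, y]) derive1 f z <= f y - f x.
Proof.
move=> xy df intdf.
have mdf := measurable_int _ intdf.
have [_ _ cv] : [/\ mu.-integrable `[x, y] (EFin \o derive1 f),
    (fun n : nat =>
        \int[mu]_(z in `[x, y]) `|(Num.min (derive1 f z) n%:R)%:E - (derive1 f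
            z)%:E|)%E @ \oo --> 0%E &
    (fun n : nat =>
        \int[mu]_(z in `[x, y]) (Num.min (derive1 f z) n%:R)%:E)%E @ \oo -->
            (\int[mu]_(z in `[x, y]) (derive1 f z)%:E)%E].
  apply: (@dominated_convergence _ _ _ mu `[x, y] (measurable_itv _)
    (fun n z => (Num.min (derive1 f z) n%:R)%:E) (EFin \o derive1 f) (fun z =>
        `|(derive1 f z)%:E|)%E) => //.
  - by move=> n; have /measurable_int := integrable_minr n (measurable_itv _) intdf.
  - apply: aeW => z _; apply: cvg_near_cst; near=> n.
    congr EFin; apply/min_idPl.
    by near: n; exact: nbhs_infty_ger.
  - exact: integrable_abse.
  - apply: aeW => z n _ /=; rewrite lee_fin.
    have [//|nf] := leP (derive1 f z) n%:R.
    by rewrite ger0_norm // (le_trans (ltW nf)) // ler_norm.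
rewrite -lee_fin /Rintegral fineK; last exact: integrable_fin_num.
rewrite -(cvg_lim _ cv) //.
apply: lime_le; first by apply/cvg_ex; eexists; exact: cv.
apply: nearW => n.
have intm := integrable_minr n (measurable_itv _) intdf.
by rewrite -[leLHS]fineK ?lee_fin;
    [exact: Rintegral_minr_derive1_le|exact: integrable_fin_num].
Unshelve. all: by end_near. Qed.

Lemma Rintegral_derive1 f x y : x < y ->
  (forall z, x <= z <= y -> derivable f z 1) ->
  mu.-integrable `[x, y] (EFin \o derive1 f) ->
  \int[mu]_(z in `[x, y]) derive1 f z = f y - f x.
Proof.
move=> xy df intdf; apply/eqP; rewrite eq_le Rintegral_derive1_le //=.
have dNf z : x <= z <= y -> derivable (- f) z 1 by move=> /df; exact: derivableN.
have dNfE z : z \in `[x, y]%classic -> derive1 (- f) z = (- 1) * derive1 f z.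
  by rewrite inE /= in_itv /= mulN1r => zxy; rewrite derive1N //; exact: df.
have intdNf : mu.-integrable `[x, y] (EFin \o derive1 (- f)).
  have := @integrableZl _ _ _ mu _ (measurable_itv `[x, y]) (- 1) _ intdf.
  by apply: eq_integrable => // z zxy /=; rewrite dNfE ?EFinM // inE.
have := Rintegral_derive1_le xy dNf intdNf.
have -> : \int[mu]_(z in `[x, y]) derive1 (- f) z =
    \int[mu]_(z in `[x, y]) (- 1 * derive1 f z).
  exact: eq_Rintegral.
rewrite RintegralZl // mulN1r !fctE => h.
by rewrite -lerN2 (le_trans h) // opprB opprK addrC.
Qed.

(** The equality holds on [c, t] for [a < c], where [f] is derivable up to the
    endpoints; [c] then tends to [a]. *)
Lemma FTC2_derivable_oo f a b t : {within `[a, b], continuous f} ->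
  (forall z, z \in `]a, b[ -> derivable f z 1) ->
  mu.-integrable `]a, b[ (EFin \o derive1 f) -> a < t -> t < b ->
  \int[mu]_(z in `]a, t[) derive1 f z = f t - f a.
Proof.
move=> cf df intdf at_ tb.
have ab : a < b by exact: lt_trans tb.
pose phi := derive1 f \_ `]a, b[.
have intphi : intR phi.
  by rewrite -restrict_EFin; apply/integrable_restrict => //=; rewrite setTI.
have phiE (A : set R) : A `<=` `]a, b[ -> \int[mu]_(z in A) derive1 f z =
    \int[mu]_(z in A) phi z.
  move=> Aab; apply: eq_Rintegral => z; rewrite inE => /Aab zab.
  by rewrite /phi patchE mem_set.
rewrite phiE; last by move=> z /=; rewrite !in_itv /= => /andP[-> /lt_trans]; exact.
rewrite Rintegral_itv_bndo_bndc; last exact: integrableS intphi.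
rewrite Rintegral_itv_obnd_cbnd; last exact: integrableS intphi.
pose P c := \int[mu]_(z in `[a, c]) phi z.
rewrite -/(P t).
have P0 : P c @[c --> a^'+] --> 0.
  apply: cvg_at_right_filter.
  by apply: (parameterized_integral_cvg_left at_); exact: integrableS intphi.
have fa : f c @[c --> a^'+] --> f a by have /(continuous_within_itvP _ ab)[] := cf.
have Pf : P c - f c @[c --> a^'+] --> 0 - f a by exact: cvgB.
have Pt : P c - f c @[c --> a^'+] --> P t - f t.
  apply: cvg_near_cst; apply: filterS2 (nbhs_right_gt a) (nbhs_right_lt at_) => c ac ct.
  have ctab : `[c, t] `<=` `]a, b[.
    move=> z /=; rewrite !in_itv /= => /andP[cz zt].
    by rewrite (lt_le_trans ac) // (le_lt_trans zt).
  have := Rintegral_itvcc_split intphi (ltW ac) (ltW ct); rewrite -/(P t) -/(P c).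
  rewrite -phiE // Rintegral_derive1 //.
  - move=> PE; have -> : P t = f t - f c + P c by rewrite -PE subrK.
    ring.
  - by move=> z zct; apply: df; exact: ctab.
  - exact: integrableS intdf.
have := cvg_unique _ Pf Pt; rewrite sub0r => /(_ _) h.
have {}h : - f a = P t - f t by exact: h.
by rewrite -[P t](subrK (f t)) -h addrC.
Qed.

End derivative_integral.

(** * Convolution of integrable functions on the line *)

Section convolution.
Context {R : realType}.
Implicit Types (f g h p w : R -> R) (c t : R).
Local Notation mu := (@lebesgue_measure R).
Local Notation intR f := (mu.-integrable setT (EFin \o f)).
Local Notation norm1 f := (\int[mu]_x `|(f x)%:E|)%E.

(** Real-valued, so that it is 0 where the integral diverges.  This only
    matters on a null set when [f] and [g] are integrable. *)
Definition convolve f g (t : R) : R := \int[mu]_s (f (t - s) * g s).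

Lemma measurable_convolve_kernel f g :
  measurable_fun setT f -> measurable_fun setT g ->
  measurable_fun (setT : set (measurableTypeR R * measurableTypeR R))
    (fun z => (f (z.1 - z.2) * g z.2)%:E).
Proof.
move=> mf mg; apply/measurable_EFinP; apply: measurable_funM.
  apply: (measurableT_comp mf); apply: measurable_funB.
    exact: measurable_fst.
  exact: measurable_snd.
exact: (measurableT_comp mg measurable_snd).
Qed.

(** Tonelli's theorem and translation invariance.  Integrability of the kernel,
    and with it all the properties of convolution, comes from here. *)
Lemma integral_convolve_kernel f g :
  measurable_fun setT f -> measurable_fun setT g ->
  (\int[mu]_t \int[mu]_s `|(f (t - s) * g s)%:E| = norm1 f * norm1 g)%E.
Proof.
move=> mf mg.
have mk := measurableT_comp (@abse_measurable R setT) (measurable_convolve_kernel mf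
    mg).
rewrite (fubini_tonelli (m1 := mu) (m2 := mu) (fun z =>
    `|(f (z.1 - z.2) * g z.2)%:E|%E)) //=.
transitivity (\int[mu]_s (norm1 f * `|(g s)%:E|))%E.
  apply: eq_integral => s _.
  under eq_integral do rewrite normrM EFinM.
  rewrite ge0_integralZr //.
    rewrite (@integral_shift _ s (fun s => `|(f s)%:E|%E)) //.
    by apply: measurableT_comp => //; exact/measurable_EFinP.
  apply/measurable_EFinP; apply: measurableT_comp => //.
  by apply: (measurableT_comp mf); exact: measurable_funB.
rewrite ge0_integralZl //.
  by apply: measurableT_comp => //; exact/measurable_EFinP.
exact: integral_ge0.
Qed.

Lemma integrable_convolve_kernel f g : intR f -> intR g ->
  (mu \x mu)%E.-integrable (setT : set (measurableTypeR R * measurableTypeR R))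
    (fun z => (f (z.1 - z.2) * g z.2)%:E).
Proof.
move=> intf intg; have mf := intR_measurable intf; have mg := intR_measurable intg.
apply/integrable12ltyP; first exact: measurable_convolve_kernel.
rewrite /= integral_convolve_kernel //.
by move/integrableP : intf => [_ ?]; move/integrableP : intg => [_ ?];
    rewrite lte_mul_pinfty // ?integral_ge0 // ge0_fin_numE // integral_ge0.
Qed.

Lemma ae_integrable_convolve f g : intR f -> intR g ->
  {ae mu, forall t, intR (fun s => f (t - s) * g s)}.
Proof. by move=> intf intg;
    exact: ae_integrable1 (integrable_convolve_kernel intf intg). Qed.

Lemma integrable_convolve f g : intR f -> intR g -> intR (convolve f g).
Proof.
move=> intf intg.
have := integrable_fubini_F (integrable_convolve_kernel intf intg).
move=> iF; have /measurable_int mF := iF.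
apply: le_integrable iF => //.
  apply/measurable_EFinP;
      exact: (measurableT_comp (@fine_measurable _ setT measurableT) mF).
move=> x _ /=; rewrite /convolve /Rintegral /fubini_F /=.
by case: (\int[_]_(_ in _) _)%E => //= *; rewrite ?leey // normr0 leey.
Qed.

Lemma norm1_convolve_le f g : intR f -> intR g ->
  (norm1 (convolve f g) <= norm1 f * norm1 g)%E.
Proof.
move=> intf intg.
rewrite -integral_convolve_kernel //; [|exact: intR_measurable..].
apply: ge0_le_integral => //.
- apply: measurableT_comp => //; by have /measurable_int :=
    integrable_convolve intf intg.
- have := measurable_fun_fubini_tonelli_F (m2 :=
    mu) _ (measurableT_comp (@abse_measurable R setT) (measurable_convolve_kernel
        (intR_measurable intf) (intR_measurable intg))).
  by apply => // x; rewrite /= ?lee_fin.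
- move=> x _; apply: (@le_trans _ _ (`| \int[mu]_s (f (x - s) * g s)%:E |)%E).
  rewrite /convolve /Rintegral.
  by case: (\int[_]_(_ in _) _)%E => //= *; rewrite ?leey // normr0 leey.
apply: le_abse_integral => //; apply/measurable_EFinP.
apply: measurable_funM; last exact: intR_measurable.
by apply: (measurableT_comp (intR_measurable intf)); exact: measurable_funB.
Qed.

Lemma convolveC f g t : intR f -> intR g -> convolve f g t = convolve g f t.
Proof.
move=> intf intg; rewrite /convolve /Rintegral.
rewrite -(@integral_reflect _ t (fun s => (f (t - s) * g s)%:E)).
  congr fine; apply: eq_integral => s _; congr EFin; rewrite mulrC; congr (_ * f _);
      ring.
apply/measurable_EFinP; apply: measurable_funM; last exact: intR_measurable.
by apply: (measurableT_comp (intR_measurable intf)); exact: measurable_reflect.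
Qed.

Lemma intR_norm f : intR f -> intR (fun x => `|f x|).
Proof. by move=> /integrable_norm. Qed.

Lemma EFin_convolve f g t : intR (fun s => f (t - s) * g s) ->
  ((convolve f g t)%:E = \int[mu]_s (f (t - s) * g s)%:E)%E.
Proof. by move=> i; rewrite /convolve /Rintegral fineK //;
    exact: integrable_fin_num. Qed.

(** Both sides integrate [f (t - r) * (g (r - s) * h s)], in the two possible
    orders.  For almost every [t] this is integrable in the pair [(s, r)], because
    the convolution of [|f|] with that of [|g|] and [|h|] converges at [t]. *)
Lemma ae_convolveA f g h : intR f -> intR g -> intR h ->
  {ae mu, forall t, convolve (convolve f g) h t = convolve f (convolve g h) t}.
Proof.
move=> intf intg inth.
have [mf mg mh] : [/\ measurable_fun setT f, measurable_fun setT g &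
    measurable_fun setT h].
  by split; exact: intR_measurable.
have intgh := integrable_convolve intg inth.
have intfg := integrable_convolve intf intg.
have [magh maf] := (intR_norm intg, intR_norm intf).
have mah := intR_norm inth.
have A1 := ae_integrable_convolve maf (integrable_convolve magh mah).
have A2 := ae_integrable_convolve intg inth.
have A3 := ae_integrable_convolve magh mah.
apply: filterS A1 => t It.
pose F (z : measurableTypeR R * measurableTypeR R) : \bar R :=
  (f (t - z.2) * (g (z.2 - z.1) * h z.1))%:E.
have mF : measurable_fun setT F.
  apply/measurable_EFinP; apply: measurable_funM.
    apply: (measurableT_comp mf); apply: measurable_funB => //; exact: measurable_snd.
  apply: measurable_funM.
    apply: (measurableT_comp mg); apply: measurable_funB;
        [exact: measurable_snd|exact: measurable_fst].
  exact: (measurableT_comp mh measurable_fst).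
have mft : measurable_fun setT (fun r : R => f (t - r)).
  by apply: (measurableT_comp mf); exact: measurable_reflect.
have intF : (mu \x mu)%E.-integrable setT F.
  apply/integrable21ltyP => //.
  have /integrableP[_] := It; apply: le_lt_trans.
  have mG : measurable_fun setT (fun r => \int[mu]_s `|F (s, r)|)%E.
    apply: (measurable_fun_fubini_tonelli_G (m1 := mu) (abse \o F)) => //=.
    exact: measurableT_comp.
  apply: ae_ge0_le_integral => //.
  - by move=> r _; exact: integral_ge0.
  - by apply: measurableT_comp => //; have /measurable_int := It.
  apply: filterS A3 => r Ir _.
  rewrite [leRHS]/= normrM EFinM normr_id.
  under eq_integral do rewrite /F /= normrM EFinM.
  rewrite ge0_integralZl //; last first.
    apply/measurable_EFinP; apply: measurableT_comp => //; apply: measurable_funM => //.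
    by apply: (measurableT_comp mg); exact: measurable_reflect.
  apply: lee_wpmul2l => //.
  apply: (@le_trans _ _ (convolve (fun x => `|g x|) (fun x => `|h x|) r)%:E);
      last first.
    by rewrite lee_fin ler_norm.
  rewrite EFin_convolve //.
  by under eq_integral do rewrite normrM.
apply: EFin_inj.
rewrite /convolve /Rintegral.
congr (fine _)%:E.
transitivity (\int[mu]_s \int[mu]_r F (s, r))%E.
  apply: ae_eq_integral => //.
  - apply/measurable_EFinP; apply: measurable_funM => //.
    by apply: (measurableT_comp (intR_measurable intfg)); exact: measurable_reflect.
  - exact: (measurable_fubini_F intF).
  apply: filterS (ae_integrable1 intF) => s /= iFs _.
  have [hs0|hs0] := eqVneq (h s) 0.
    rewrite /F /= hs0 mulr0.
    by under eq_integral do rewrite mulr0 mulr0; rewrite integral0.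
  have ifg : intR (fun r => f (t - r) * g (r - s)).
    have := integrableZl measurableT (h s)^-1 iFs.
    apply: eq_integrable => // r _ /=.
    by rewrite /F /= -EFinM; congr EFin; field.
  transitivity ((\int[mu]_r (f (t - r) * g (r - s))%:E) * (h s)%:E)%E; last first.
    rewrite -integralZr //; apply: eq_integral => r _.
    by rewrite /F /= -EFinM mulrA.
  rewrite EFinM; congr (_ * _)%E.
  have mfg : measurable_fun setT (fun u : R => (f (t - s - u) * g u)%:E).
    apply/measurable_EFinP; apply: measurable_funM => //.
    by apply: (measurableT_comp mf); exact: measurable_reflect.
  have shE r : (f (t - r) * g (r - s) = f (t - s - (r - s)) * g (r - s)).
    by congr (f _ * _); ring.
  rewrite EFin_convolve; last first.
    apply/integrableP; split => //.
    rewrite -(@integral_shift _ s (fun u => `|(f (t - s - u) * g u)%:E|)%E) //;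
        last first.
      exact: measurableT_comp mfg.
    by under eq_integral do rewrite -shE; have /integrableP[] := ifg.
  rewrite -(@integral_shift _ s (fun u => (f (t - s - u) * g u)%:E)) //.
  by apply: eq_integral => r _; rewrite shE.
rewrite (Fubini intF).
apply: ae_eq_integral => //.
- exact: (measurable_fubini_G intF).
- by apply/measurable_EFinP; apply: measurable_funM => //;
    exact: (intR_measurable intgh).
apply: filterS A2 => r Ir _ /=.
by rewrite EFinM EFin_convolve // -integralZl.
Qed.

(** The integrand at [s] vanishes for [t <= s]. *)
Lemma eq_convolve_causal p f1 f2 c t : (forall x, x <= 0 -> p x = 0) ->
  (forall s, s < c -> f1 s = f2 s) -> t <= c -> convolve p f1 t = convolve p f2 t.
Proof.
move=> p0 f12 tc; apply: eq_Rintegral => s _.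
have [/f12 -> //|cs] := ltP s c.
by rewrite p0 ?mul0r // subr_le0 (le_trans tc).
Qed.

Lemma ae_eq_convolve p f1 f2 : intR p -> intR f1 -> intR f2 ->
  {ae mu, forall s, f1 s = f2 s} -> forall t, convolve p f1 t = convolve p f2 t.
Proof.
move=> intp int1 int2 f12 t; rewrite /convolve /Rintegral; congr fine.
have mpt : measurable_fun setT (fun r : R => p (t - r)).
  by apply: (measurableT_comp (intR_measurable intp)); exact: measurable_reflect.
apply: ae_eq_integral => //.
- by apply/measurable_EFinP/measurable_funM => //; exact: intR_measurable.
- by apply/measurable_EFinP/measurable_funM => //; exact: intR_measurable.
by apply: filterS f12 => s -> _.
Qed.

Lemma ae_convolveDr p f g : intR p -> intR f -> intR g ->
  {ae mu, forall t, convolve p (f \+ g) t = convolve p f t + convolve p g t}.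
Proof.
move=> intp intf intg.
apply: filterS2 (ae_integrable_convolve intp intf) (ae_integrable_convolve intp intg)
    => t it1 it2.
rewrite /convolve -RintegralD //.
by apply: eq_Rintegral => s _ /=; rewrite mulrDr.
Qed.

Lemma ae_convolveBr p f g : intR p -> intR f -> intR g ->
  {ae mu, forall t, convolve p (f \- g) t = convolve p f t - convolve p g t}.
Proof.
move=> intp intf intg.
apply: filterS2 (ae_integrable_convolve intp intf) (ae_integrable_convolve intp intg)
    => t it1 it2.
rewrite /convolve -RintegralB //.
by apply: eq_Rintegral => s _ /=; rewrite mulrBr.
Qed.

Lemma ae_convolveDl f g h : intR f -> intR g -> intR h ->
  {ae mu, forall t, convolve (f \+ g) h t = convolve f h t + convolve g h t}.
Proof.
move=> intf intg inth.
apply: filterS2 (ae_integrable_convolve intf inth) (ae_integrable_convolve intg inth)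
    => t it1 it2.
rewrite /convolve -RintegralD //.
by apply: eq_Rintegral => s _ /=; rewrite mulrDl.
Qed.

Lemma norm1_ge0 f : (0 <= norm1 f)%E. Proof. exact: integral_ge0. Qed.

Lemma norm1_fin_num f : intR f -> norm1 f \is a fin_num.
Proof. by move=> /integrableP[_ ?]; rewrite ge0_fin_numE // norm1_ge0. Qed.

(** Cutting [w] off to the right of [c] keeps the equation on (-oo, c), because
    [p] is causal.  The truncation then has an L^1 norm at most half of itself. *)
Lemma convolve_fixpoint_ae0 p w c : intR p -> (forall x, x <= 0 -> p x = 0) ->
  (norm1 p <= (2^-1)%:E)%E -> intR w ->
  {ae mu, forall t, t < c -> w t = convolve p w t} ->
  {ae mu, forall t, t < c -> w t = 0}.
Proof.
move=> intp p0 np intw wpw.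
pose w' : R -> R := w \_ `]-oo, c[.
have w'E t : t < c -> w' t = w t.
  by move=> tc; rewrite /w' patchE mem_set //= in_itv.
have intw' : intR w'.
  rewrite -restrict_EFin; apply/integrable_restrict => //=; rewrite ?setIT ?setTI.
  exact: integrableS intw.
have nw : (norm1 w' <= (2^-1)%:E * norm1 w')%E.
  apply: (@le_trans _ _ (norm1 (convolve p w'))); last first.
    by apply: (le_trans (norm1_convolve_le intp intw'));
        exact: lee_wpmul2r (norm1_ge0 _) _ _ np.
  apply: ae_ge0_le_integral => //.
  - by apply: measurableT_comp => //; have /measurable_int := intw'.
  - by apply: measurableT_comp => //; have /measurable_int :=
      integrable_convolve intp intw'.
  apply: filterS wpw => t wt _.
  have [tc|tc] := ltP t c; last first.
    rewrite /w' patchE memNset /= ?normr0 ?lee_fin //.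
    by rewrite in_itv /=; apply/negP; rewrite -leNgt.
  by rewrite w'E // wt // (eq_convolve_causal (c := c) (f2 := w') p0 _ (ltW tc)) //
      => s /w'E.
have nw0 : (norm1 w' = 0)%E.
  have := nw; have := norm1_ge0 w';
      rewrite -(fineK (norm1_fin_num intw')) -EFinM !lee_fin => h1 h2.
  congr EFin; lra.
have mw' : measurable_fun setT (EFin \o w') by have /measurable_int := intw'.
have [/(_ nw0) h _] := ae_eq_integral_abs mu measurableT mw'.
by apply: filterS h => t /(_ I) [] ht tc; rewrite -w'E.
Qed.

End convolution.

(** * Neumann series and the Volterra equation *)

Section volterra.
Context {R : realType}.
Implicit Types (f g h k p u w : R -> R) (b c t x : R).
Local Notation mu := (@lebesgue_measure R).
Local Notation intR f := (mu.-integrable setT (EFin \o f)).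
Local Notation norm1 f := (\int[mu]_x `|(f x)%:E|)%E.

Lemma intR_sum (u : nat -> R -> R) N : (forall n, intR (u n)) ->
  intR (fun x => \sum_(0 <= i < N) u i x).
Proof.
move=> intu; have :=
    @integrable_sum _ _ R mu setT measurableT nat (index_iota 0 N) xpredT (fun n =>
        EFin \o u n) (fun i _ => intu i).
by apply: eq_integrable => // x _ /=; rewrite sumEFin.
Qed.

(** The partial sums are dominated by the sum of the absolute values, which
    is integrable by monotone convergence. *)
Lemma integrable_series_cvg (u : nat -> R -> R) : (forall n, intR (u n)) ->
  (\sum_(n <oo) norm1 (u n) < +oo)%E ->
  exists2 S : R -> R, intR S &
    (fun N => norm1 (fun x => \sum_(0 <= i < N) u i x - S x)) @ \oo --> 0%E.
Proof.
move=> intu sumu.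
pose A (x : R) : \bar R := (\sum_(n <oo) `|(u n x)%:E|)%E.
have mu_ n : measurable_fun setT (u n) by exact: intR_measurable.
have mau n : measurable_fun setT (fun x => `|(u n x)%:E|)%E.
  by apply: measurableT_comp => //; exact/measurable_EFinP.
have A0 x : (0 <= A x)%E by apply: nneseries_ge0.
have intA : mu.-integrable setT A.
  apply/integrableP; split.
    exact: (@ge0_emeasurable_sum _ _ _ _ (fun n x =>
        `|(u n x)%:E|%E) xpredT (fun _ _ _ _ => abse_ge0 _) (fun n _ => mau n)).
  under eq_integral do rewrite gee0_abs //.
  by rewrite integral_nneseries.
pose S x := fine (limn_esup (fun N => (\sum_(0 <= i < N) u i x)%:E)).
have mS : measurable_fun setT S.
  apply: (measurableT_comp (@fine_measurable _ setT measurableT)).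
  apply: measurable_fun_limn_esup => N.
  by have /measurable_int := intR_sum N intu.
have [] := @dominated_convergence _ _ _ mu setT measurableT
  (fun N x => (\sum_(0 <= i < N) u i x)%:E) (EFin \o S) A.
- by move=> N; have /measurable_int := intR_sum N intu.
- exact/measurable_EFinP.
- apply: filterS (integrable_ae measurableT intA) => x /(_ I) Ax _.
  have cu : cvgn (series (u ^~ x)).
    apply: normed_cvg; apply: nnseries_is_cvg => //=.
    by move: Ax; rewrite ge0_fin_numE.
  have cE : (fun N => (\sum_(0 <= i < N) u i x)%:E) @ \oo -->
      (limn (series (u ^~ x)))%:E.
    by apply: cvg_EFin; [exact: nearW|exact: cu].
  by rewrite /= /S (cvg_limn_einf_sup cE).2.
- exact: intA.
- apply: aeW => x N _; rewrite /=.
  apply: (@le_trans _ _ (\sum_(0 <= i < N) `|(u i x)%:E|)%E).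
    by rewrite sumEFin lee_fin ler_norm_sum.
  exact: nneseries_lim_ge.
move=> intS cv _; exists S => //.
Qed.

(** The solution is the sum of the iterates of convolution with [p] on [f].
    The equation [s N.+1 = f + p * s N] between partial sums passes to the limit
    in L^1 norm. *)
Lemma neumann_series p f : intR p -> (norm1 p <= (2^-1)%:E)%E -> intR f ->
  exists2 w, intR w & {ae mu, forall t, w t = f t + convolve p w t}.
Proof.
move=> intp np intf.
pose u n := iter n (convolve p) f.
have intu n : intR (u n) by elim: n => [//|n IH]; exact: integrable_convolve.
have nu n : (norm1 (u n) <= (fine (norm1 f) / 2 ^+ n)%:E)%E.
  elim: n => [|n IH]; first by rewrite expr0 divr1 fineK // norm1_fin_num.
  apply: (le_trans (norm1_convolve_le intp (intu n))).
  apply: (@le_trans _ _ ((2^-1)%:E * (fine (norm1 f) / 2 ^+ n)%:E)%E).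
    by apply: lee_pmul => //; exact: norm1_ge0.
  by rewrite -EFinM lee_fin exprS invfM mulrCA.
have sumu : (\sum_(n <oo) norm1 (u n) < +oo)%E.
  apply: (@le_lt_trans _ _ (\sum_(n <oo) (fine (norm1 f) / 2 ^+ n)%:E)%E).
    by apply: lee_nneseries => [n _ _|n _]; [exact: norm1_ge0|exact: nu].
  have : eseries (fun n => (fine (norm1 f) / 2 ^+ n)%:E) @ \oo -->
      (fine (norm1 f) * (1 - 2^-1)^-1)%:E.
    apply: cvg_EFin.
      by apply: nearW => //= x; rewrite /eseries/= sumEFin.
    rewrite [X in X @ _ --> _](_ : _ = series (geometric (fine (norm1 f)) 2^-1)).
      by apply: cvg_geometric_series; rewrite ger0_norm ?invr_ge0 // invf_lt1 // ltr1n.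
    by apply/funext => n; rewrite /eseries /series /= sumEFin /=; apply: eq_bigr =>
        i _; rewrite exprVn.
  by move=> /cvg_lim; rewrite /eseries /= => -> //; rewrite ltry.
have [w intw wcv] := integrable_series_cvg intu sumu.
exists w => //.
pose s N x := \sum_(0 <= i < N) u i x.
have ints N : intR (s N) by exact: intR_sum.
have sS N : {ae mu, forall t, s N.+1 t = f t + convolve p (s N) t}.
  elim: N => [|N IH].
    apply: aeW => t; rewrite /s big_nat1 /= /convolve.
    under eq_Rintegral do rewrite big_geq // mulr0.
    by rewrite Rintegral_cst // ?mul0r ?addr0.
  apply: filterS2 (ae_convolveDr intp (ints N) (intu N)) IH => t cD IH.
  rewrite [in LHS]/s big_nat_recr //= -/(s N.+1 t) IH -addrA -cD.
  by congr (_ + _); congr convolve; apply/funext => x; rewrite /s big_nat_recr.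
pose D := fun t => w t - (f t + convolve p w t).
have intD : intR D.
  have := integrableB measurableT intw (integrableD measurableT intf
      (integrable_convolve intp intw)).
  by apply: eq_integrable.
pose e N := norm1 (fun x => s N x - w x).
have intsw N : intR (fun x => s N x - w x).
  by have := integrableB measurableT (ints N) intw; apply: eq_integrable.
have De N : (norm1 D <= e N.+1 + norm1 p * e N)%E.
  apply: (@le_trans _ _ (e N.+1 + norm1 (convolve p (s N \- w)))%E); last first.
    by apply: leeD2l; apply: norm1_convolve_le => //; exact: intsw.
  have intc := integrable_convolve intp (intsw N).
  have mabs v : intR v -> measurable_fun setT (fun x => `|(v x)%:E|)%E.
    by move=> /measurable_int mv; exact: measurableT_comp.
  rewrite -ge0_integralD //; [|exact: mabs..].
  apply: ae_ge0_le_integral => //; [exact: mabs|by move=> *; exact: adde_ge0| |].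
    by apply: emeasurable_funD; exact: mabs.
  apply: filterS2 (ae_convolveBr intp (ints N) intw) (sS N) => t cB sSt _.
  rewrite -EFinD lee_fin cB /D.
  have -> : w t - (f t + convolve p w t) = - (s N.+1 t - w t) +
      (convolve p (s N) t - convolve p w t).
    by rewrite sSt; ring.
  by rewrite (le_trans (ler_normD _ _)) // normrN.
have e0 : (fun N => e N.+1 + norm1 p * e N)%E @ \oo --> 0%E.
  rewrite -[X in _ --> X]adde0; apply: cvgeD => //.
    by have := wcv; rewrite -(cvg_shiftS e).
  rewrite -(mule0 (norm1 p)); apply: cvgeZl => //; exact: norm1_fin_num.
have nD0 : (norm1 D = 0)%E.
  apply/eqP; rewrite eq_le norm1_ge0 andbT.
  rewrite -(cvg_lim _ e0) //.
  apply: lime_ge; first by apply/cvg_ex; exists 0%E.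
  exact: nearW.
have mD : measurable_fun setT (EFin \o D) by have /measurable_int := intD.
have [/(_ nD0) h _] := ae_eq_integral_abs mu measurableT mD.
by apply: filterS h => t /(_ I) [] /eqP; rewrite subr_eq0 => /eqP.
Qed.

(** Writing [delta] for the unit of convolution, [K'] is the quotient of [K] by
    [delta - p], and the hypothesis says that [K * k] is [(delta - p) * u] on
    (-oo, b).  The difference between [K' * k] and [u] is then a fixed point of
    convolution with [p] there. *)
Lemma volterra_sonine p k K u b : intR p -> intR k -> intR K -> intR u ->
  (forall x, x <= 0 -> p x = 0) -> (forall x, x <= 0 -> K x = 0) ->
  (norm1 p <= (2^-1)%:E)%E ->
  {ae mu, forall t, t < b -> convolve K k t = u t - convolve p u t} ->
  exists2 K' : R -> R, intR K' /\ (forall x, x <= 0 -> K' x = 0) &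
    {ae mu, forall t, t < b -> convolve K' k t = u t}.
Proof.
move=> intp intk intK intu p0 K0 np Kk.
have [w intw wE] := neumann_series intp np intK.
have w0 : {ae mu, forall t, t < 0 -> w t = 0}.
  apply: (convolve_fixpoint_ae0 intp p0 np intw).
  by apply: filterS wE => t -> t0; rewrite K0 ?add0r // ltW.
pose K' := w \_ `]0, +oo[.
have intK' : intR K'.
  rewrite -restrict_EFin; apply/integrable_restrict => //=; rewrite ?setIT ?setTI.
  exact: integrableS intw.
have K'w : {ae mu, forall t, K' t = w t}.
  (* [w] vanishes almost everywhere on the negative half-line, and the
     point 0 is negligible. *)
  have neq0 : {ae mu, forall t : R, t <> 0}.
    exists [set 0]; split => //; first exact: lebesgue_measure_set1.
    by move=> t /= /contrapT.
  apply: filterS2 w0 neq0 => t wt t0; rewrite /K' patchE.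
  case: ifPn => //; rewrite notin_setE /= in_itv /= andbT => /negP;
      rewrite -leNgt le_eqVlt.
  by move=> /predU1P[//|/wt].
have intpK' := integrable_convolve intp intK'.
have K'E : {ae mu, forall t, K' t = K t + convolve p K' t}.
  apply: filterS2 (K'w) wE => t -> ->; congr (_ + _).
  by apply: ae_eq_convolve => //; apply: filterS K'w => ? ->.
exists K'.
  split=> // x x0; rewrite /K' patchE memNset //= in_itv /= andbT.
  by apply/negP; rewrite -leNgt.
have intK'k := integrable_convolve intK' intk.
have intKs : intR (K \+ convolve p K').
  by have := integrableD measurableT intK intpK'; apply: eq_integrable.
have cE : {ae mu, forall t, convolve K' k t = convolve K k t +
    convolve p (convolve K' k) t}.
  apply: filterS2 (ae_convolveA intp intK' intk) (ae_convolveDl intK intpK' intk) =>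
      t assoc cD.
  rewrite -assoc -cD convolveC // [RHS]convolveC //.
  exact: ae_eq_convolve.
pose d := convolve K' k \- u.
have intd : intR d.
  by have := integrableB measurableT intK'k intu; apply: eq_integrable.
have d0 : {ae mu, forall t, t < b -> d t = 0}.
  apply: (convolve_fixpoint_ae0 intp p0 np intd).
  apply: filterS3 Kk cE (ae_convolveBr intp intK'k intu) => t Kkt ct cB tb.
  by rewrite cB /d /= ct Kkt //; ring.
by apply: filterS d0 => t dt /dt /eqP; rewrite /d /= subr_eq0 => /eqP.
Qed.

End volterra.

(** * Exponential weights *)

Section weights.
Context {R : realType}.
Implicit Types (f g : R -> R) (b t s x l : R).
Local Notation mu := (@lebesgue_measure R).
Local Notation intR f := (mu.-integrable setT (EFin \o f)).
Local Notation norm1 f := (\int[mu]_x `|(f x)%:E|)%E.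

(** The weight turns convolution of functions on (0, b) into convolution on
    the line and only multiplies the result by [exp (- l t)], while a large [l]
    makes the L^1 norm small. *)
Definition weighted l b f := (fun x => expR (- (l * x)) * f x) \_ `]0, b[.

Lemma weightedE l b f x : 0 < x -> x < b -> weighted l b f x = expR (- (l * x)) * f x.
Proof. by move=> x0 xb; rewrite /weighted patchE mem_set //= in_itv /= x0. Qed.

Lemma weighted_le0 l b f x : x <= 0 -> weighted l b f x = 0.
Proof.
move=> x0; rewrite /weighted patchE memNset //= in_itv /=.
by move=> /andP[]; rewrite ltNge x0.
Qed.

Lemma integrable_weighted l b f : 0 <= l -> L1 b f -> intR (weighted l b f).
Proof.
move=> l0 intf; rewrite -restrict_EFin; apply/integrable_restrict => //=;
    rewrite ?setIT ?setTI.
have /measurable_int/measurable_EFinP mf := intf.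
apply: (le_integrable _ _ _ intf) => //.
  apply/measurable_EFinP; apply: measurable_funM => //.
  apply: measurableT_comp => //.
  apply: (measurableT_comp (@oppr_measurable R setT)).
  by apply: measurable_funM => //; exact: measurable_cst.
move=> x /=; rewrite in_itv /= => /andP[x0 _].
rewrite lee_fin normrM ler_piMl // ger0_norm ?expR_ge0 //.
by rewrite -expR0 ler_expR oppr_le0 mulr_ge0 // ltW.
Qed.

Lemma weighted_kernel l b f g t s : 0 < t -> t < b ->
  weighted l b f (t - s) * weighted l b g s =
  ((fun s => expR (- (l * t)) * (f (t - s) * g s)) \_ `]0, t[) s.
Proof.
move=> t0 tb; rewrite [RHS]patchE.
case: ifPn; rewrite ?inE ?notin_setE /= in_itv /=.
  move=> /andP[s0 st]; rewrite !weightedE ?subr_gt0 // ?(lt_trans st) //; last first.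
    by rewrite (lt_trans _ tb) // ltrBlDr ltrDl.
  rewrite mulrACA -expRD; congr (expR _ * _); ring.
move=> /negP; rewrite negb_and -!leNgt => /orP[s0|ts].
  by rewrite (weighted_le0 _ _ _ s0) mulr0.
by rewrite weighted_le0 ?mul0r // subr_le0.
Qed.

Lemma convolve_weighted_le0 l b f g t : t <= 0 ->
    convolve (weighted l b f) (weighted l b g) t = 0.
Proof.
move=> t0; rewrite /convolve (@eq_Rintegral _ _ _ _ _ (cst 0)); last first.
  move=> s _ /=; have [s0|s0] := leP s 0;
      first by rewrite (weighted_le0 _ _ _ s0) mulr0.
  by rewrite weighted_le0 ?mul0r // subr_le0 (le_trans t0) // ltW.
by rewrite Rintegral_cst // mul0r.
Qed.

Lemma sonine_conv_weighted l b f g t : 0 < t -> t < b ->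
  intR (fun s => weighted l b f (t - s) * weighted l b g s) ->
  sonine_conv f g t = (expR (l * t) * convolve (weighted l b f) (weighted l b g) t)%:E.
Proof.
move=> t0 tb intw.
rewrite /sonine_conv integral_mkcond EFinM EFin_convolve // -integralZl //.
apply: eq_integral => s _; rewrite weighted_kernel // -EFinM !patchE.
case: ifPn => _; last by rewrite mulr0.
by rewrite expRN mulVKf // gt_eqF // expR_gt0.
Qed.

Lemma convolve_weighted_cst1 l b f t : 0 < t -> t < b -> L1 b f ->
  convolve (weighted l b f) (weighted l b (fun=> 1)) t =
  expR (- (l * t)) * \int[mu]_(s in `]0, t[) f s.
Proof.
move=> t0 tb intf.
have intft : mu.-integrable `]0, t[ (EFin \o f).
  apply: integrableS intf => //= s /=; rewrite !in_itv /= => /andP[-> st].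
  exact: lt_trans tb.
rewrite -RintegralZl // [RHS]Rintegral_mkcond.
pose G := (fun x => expR (- (l * t)) * f x) \_ `]0, t[.
have mG : measurable_fun setT (EFin \o G).
  rewrite -restrict_EFin; apply/(measurable_restrictT _ _).1 => //.
  by have /measurable_int :=
      @integrableZl _ _ _ mu _ (measurable_itv `]0, t[) (expR (- (l * t))) _ intft.
rewrite /Rintegral -(@integral_reflect _ t (EFin \o G)) //; congr fine.
apply: eq_integral => s _; rewrite weighted_kernel // /= /G !patchE; congr EFin.
rewrite mulr1.
congr (if _ then _ else _).
by apply/idP/idP; rewrite !inE /= !in_itv /= => /andP[h1 h2]; apply/andP; split; lra.
Qed.

(** Dominated convergence as [l] tends to infinity along the integers. *)
Lemma small_weight b f : L1 b f ->
  exists2 l, 0 <= l & (norm1 (weighted l b f) <= (2^-1)%:E)%E.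
Proof.
move=> intf.
have intw n : intR (weighted n%:R b f) by exact: integrable_weighted.
pose D := (EFin \o f) \_ `]0, b[.
have intD : mu.-integrable setT D by apply/integrable_restrict => //=; rewrite setTI.
have [] := @dominated_convergence _ _ _ mu setT measurableT
  (fun n x => (weighted n%:R b f x)%:E) (cst 0%E) (abse \o D).
- by move=> n; have /measurable_int := intw n.
- exact: measurable_cst.
- apply: aeW => x _ /=.
  have [xb|xb] := boolP (x \in `]0, b[%classic); last first.
    rewrite [X in X @ _](_ : _ = cst 0%E); first exact: cvg_cst.
    by apply/funext => n; rewrite /weighted patchE (negbTE xb).
  apply: cvg_EFin; first exact: nearW.
  rewrite [X in X @ _](_ : _ = (fun n => expR (- x) ^+ n * f x)); last first.
    by apply/funext => n; rewrite /= /weighted patchE xb -mulrN expRM_natl.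
  rewrite -(mul0r (f x)); apply: cvgM; last exact: cvg_cst.
  move: xb; rewrite inE /= in_itv /= => /andP[x0 _].
  by apply: cvg_expr; rewrite ger0_norm ?expR_ge0 // -expR0 ltr_expR oppr_lt0.
- exact: integrable_abse.
- apply: aeW => x n _ /=; rewrite /weighted /D !patchE.
  case: ifPn => [|_]; last by rewrite normr0 abse0.
  rewrite inE /= in_itv /= => /andP[x0 _].
  rewrite lee_fin normrM ler_piMl // ger0_norm ?expR_ge0 //.
  by rewrite -expR0 ler_expR oppr_le0 mulr_ge0 // ltW.
move=> _ cv _.
have h2 : 0 < 2^-1 :> R by rewrite invr_gt0.
have /fine_cvgP[_ /cvgr_lt/(_ _ h2)] := cv.
move=> /filter_ex[n nlt]; exists n%:R => //.
rewrite -[leLHS]fineK ?norm1_fin_num // lee_fin; apply: ltW; move: nlt => /=.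
by under eq_integral do rewrite subr0.
Qed.

End weights.

(** * The two Sonine conditions *)

Section sonine_conditions.
Context {R : realType}.
Implicit Types (g k K : R -> R) (b t s x l : R).
Local Notation mu := (@lebesgue_measure R).
Local Notation intR f := (mu.-integrable setT (EFin \o f)).

Lemma SC_gSC b k : SC b k -> gSC b k.
Proof.
move=> [K intK KE]; exists K, (cst 1); split => //.
  by split=> [|t _]; [apply: continuous_subspaceT => t;
      exact: cvg_cst|exact: derivable_cst].
rewrite /L1 (_ : derive1 (cst 1 : R -> R) = cst 0); first exact: integrable0.
by apply/funext => x; rewrite derive1_cst.
Qed.

(** After multiplication by [exp (- l t)], the equation [g t = 1 + \int_0^t g'] is
    the hypothesis of [volterra_sonine] for the weighted [K], [k], [- g'] and
    [u = 1]. *)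
Lemma gSC_SC b k : L1 b k -> gSC b k -> SC b k.
Proof.
move=> intk [K [g [intK [cg dg] intdg g0 KE]]].
have intNdg : L1 b (fun x => - derive1 g x).
  have := @integrableN _ _ _ mu _ (EFin \o derive1 g) intdg.
  by apply: eq_integrable.
have [l l0 lsmall] := small_weight intNdg.
pose p := weighted l b (fun x => - derive1 g x).
pose K1 := weighted l b K.
pose k1 := weighted l b k.
pose u := weighted l b (fun=> 1).
have intp : intR p by exact: integrable_weighted.
have intK1 : intR K1 by exact: integrable_weighted.
have intk1 : intR k1 by exact: integrable_weighted.
have int1 : L1 b (fun=> 1).
  apply/integrableP; split; first exact/measurable_EFinP/measurable_cst.
  rewrite integral_cst //= lebesgue_measure_itv /=; case: ifP => _;
      rewrite ?mule0 ?ltry // -EFinM ltry.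
have intu : intR u by exact: integrable_weighted.
have K1k1 : {ae mu, forall t, t < b -> convolve K1 k1 t = u t - convolve p u t}.
  apply: filterS2 KE (ae_integrable_convolve intK1 intk1) => t KEt it tb.
  have [t0|t0] := leP t 0.
    by rewrite !convolve_weighted_le0 // /u weighted_le0 // subr0.
  have := KEt; rewrite /= in_itv /= t0 tb => /(_ isT).
  rewrite (sonine_conv_weighted t0 tb it) => -[gt].
  rewrite convolve_weighted_cst1 // /u weightedE //.
  have -> : \int[mu]_(s in `]0, t[) - derive1 g s = - (g t - 1).
    rewrite -g0 -(FTC2_derivable_oo cg dg intdg t0 tb).
    rewrite -mulN1r -RintegralZl //.
      by apply: eq_Rintegral => s _; rewrite mulN1r.
    apply: integrableS intdg => //= s /=; rewrite !in_itv /= => /andP[-> st].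
    exact: lt_trans tb.
  rewrite -gt -/K1 -/k1 expRN.
  by field; rewrite gt_eqF // expR_gt0.
have [K' [intK' K'0] K'E] := volterra_sonine intp intk1 intK1 intu
  (fun x => @weighted_le0 _ l b _ x) (fun x => @weighted_le0 _ l b _ x) lsmall K1k1.
(* Undoing the weight. *)
pose Kn x := expR (l * x) * K' x.
have KnE t : t < b -> (fun s => weighted l b Kn (t - s) * k1 s) = (fun s =>
    K' (t - s) * k1 s).
  move=> tb; apply/funext => s.
  have [s0|s0] := leP s 0; first by rewrite /k1 (weighted_le0 _ _ _ s0) !mulr0.
  congr (_ * _).
  have [ts0|ts0] := leP (t - s) 0; first by rewrite weighted_le0 // K'0.
  rewrite weightedE //; last by rewrite (lt_trans _ tb) // ltrBlDr ltrDl.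
  by rewrite /Kn expRN mulKf // gt_eqF // expR_gt0.
exists Kn.
  have intK'b : L1 b K' by exact: integrableS intK'.
  have intM :=
      @integrableZl _ _ _ mu _ (measurable_itv `]0, b[) (expR (l * b)) _ intK'b.
  apply: le_integrable intM => //.
    apply/measurable_EFinP; apply: measurable_funM.
      exact: measurableT_comp.
    by have /measurable_int/measurable_EFinP := intK'b.
  move=> x /=; rewrite in_itv /= => /andP[_ xb].
  rewrite lee_fin /Kn !normrM ler_wpM2r // !ger0_norm ?expR_ge0 //.
  by rewrite ler_expR ler_wpM2l // ltW.
apply: filterS2 K'E (ae_integrable_convolve intK' intk1) => t K'Et it.
rewrite /= in_itv /= => /andP[t0 tb].
rewrite (sonine_conv_weighted (l := l) (b := b) t0 tb); last by rewrite KnE.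
congr EFin.
have -> : convolve (weighted l b Kn) (weighted l b k) t =
    convolve K' k1 t by rewrite /convolve KnE.
by rewrite K'Et // /u weightedE // expRN mulr1 mulfV // gt_eqF // expR_gt0.
Qed.

End sonine_conditions.

Unset Implicit Arguments.

Theorem theorem3p5 (R : realType) (b : R) (k : R -> R)
    (hb : 0 < b) (hk : L1 b k) :
  SC b k <-> gSC b k.
Proof. by split; [exact: SC_gSC|exact: gSC_SC]. Qed.
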